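(* Let $\mathcal{Y}$ be a finite set, let $K>2$ be a fixed integer, let $S$ be a fixed set of $K$ indices, and let $\pi$ and $\mu_i$, $i\in S$, be full-support distributions on $\mathcal{Y}$ with $\mu_i\ne\pi$ for each $i\in S$. Then, as $M\to\infty$, for each $i \in S$ the minimizer $p^*$ in $$\min_{p\in\mathcal{P}(\mathcal{Y})}\left(D(\mu_i\|p)+(M-2K)D(\pi\|p)\right)$$ tends to $\pi$, and $$\min_{i\in S}\min_{p\in\mathcal{P}(\mathcal{Y})}\left(D(\mu_i\|p)+(M-2K)D(\pi\|p)\right)\to\min_{i\in S}D(\mu_i\|\pi).$$ That is, the coefficient on the left, which gives the asymptotic performance guarantee when neither the $\mu_i$ nor $\pi$ is known, converges to the coefficient giving the guarantee when $\pi$ is known.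
   Context: $\mathcal{P}(\mathcal{Y})$ is the set of probability distributions on the finite set $\mathcal{Y}$, and $D(p\|q)=\sum_{y\in\mathcal{Y}}p(y)\log\frac{p(y)}{q(y)}$ (natural logarithm) is relative entropy. $M$ is the number of observation sequences, with $M>2K$; $K$ is the known number of outliers, $S$ the outlier set, $\mu_i$ the distribution of outlier $i\in S$, and $\pi$ the typical distribution. The asymptotic performance guarantee of a test is the coefficient $c$ in the bound $\mathbb{E}_S[N^*]\le\frac{-\log P_{\max}}{c}(1+o(1))$ on its expected stopping time $N^*$ under hypothesis $S$ in terms of its maximal error probability $P_{\max}$. *)

(* Defs.v *)
(* MathComp with MathComp-Analysis. *)
From HB Require Import structures.
From mathcomp Require Import all_boot all_order all_algebra finmap.
From mathcomp Require Import boolp classical_sets reals ereal topology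
  normedtype sequences exp.
Set Implicit Arguments.
Unset Strict Implicit.
Unset Printing Implicit Defensive.
Import Order.TTheory GRing.Theory Num.Theory.
Local Open Scope classical_set_scope.
Local Open Scope ring_scope.
Local Open Scope ereal_scope.

Definition distributions (R : realType) (Y : finType) : set (Y -> R) :=
  [set p | (forall y, 0 <= p y)%R /\ (\sum_y p y = 1)%R].

Definition full_support (R : realType) (Y : finType) (p : Y -> R) : Prop :=
  forall y, (0 < p y)%R.

(* One term of the relative entropy, with the usual conventions
   0 log (0 / q) = 0 and p log (p / 0) = +oo for p > 0. The latter matters
   because the minimum over all distributions also ranges over those without
   full support; MathComp's p / 0 = 0 would make the term finite. *)
Definition kl_term (R : realType) (p q : R) : \bar R :=
  if p == 0%R then 0 else if q == 0%R then +oo else (p * ln (p / q))%:E.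

Definition kl (R : realType) (Y : finType) (p q : Y -> R) : \bar R :=
  \sum_(y : Y) kl_term (p y) (q y).

(* The natural-number subtraction M - 2K is truncated, hence it is only
   meaningful for M > 2K. *)
Definition objective (R : realType) (Y : finType) (K M : nat)
    (mu pi p : Y -> R) : \bar R :=
  kl mu p + ((M - 2 * K)%N%:R)%:E * kl pi p.

Definition is_minimizer (R : realType) (T : Type) (A : set T)
    (f : T -> \bar R) (x : T) : Prop :=
  A x /\ forall y, A y -> f x <= f y.

(* min over i in S; the neutral element +oo is only the value for S empty. *)
Definition min_over (R : realType) (S : {fset nat}) (f : nat -> \bar R) :
    \bar R :=
  \big[Order.min/+oo]_(i <- S) f i.

(* The guarantee when neither pi nor the mu_i are known. *)
Definition coef_unknown (R : realType) (Y : finType) (S : {fset nat})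
    (K M : nat) (mu : nat -> Y -> R) (pi : Y -> R) : \bar R :=
  min_over S (fun i =>
    ereal_inf [set objective K M (mu i) pi p | p in @distributions R Y]).

(* The guarantee when pi is known. *)
Definition coef_known_typical (R : realType) (Y : finType) (S : {fset nat})
    (mu : nat -> Y -> R) (pi : Y -> R) : \bar R :=
  min_over S (fun i => kl (mu i) pi).

(* Main.v *)
Require Import Defs.
From HB Require Import structures.
From mathcomp Require Import all_boot all_order all_algebra finmap.
From mathcomp Require Import boolp classical_sets reals ereal topology
  normedtype sequences exp.
From mathcomp Require Import ring lra.
Set Implicit Arguments.
Unset Strict Implicit.
Unset Printing Implicit Defensive.
Import Order.TTheory GRing.Theory Num.Theory.
Import numFieldNormedType.Exports.
Local Open Scope fset_scope.
Local Open Scope classical_set_scope.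
Local Open Scope ring_scope.

(** With [w = M - 2 K], put [q = (mu + w pi) / (1 + w)]. For every
    distribution [p] of full support, expanding the logarithms gives the
    compensation identity
      [D(mu|p) + w D(pi|p) = D(mu|q) + w D(pi|q) + (1 + w) D(q|p)],
    and the objective is infinite when [p] has a zero ([objective_eqy]). By
    Gibbs' inequality [D(q|p) >= 0], with equality only at [p = q], so [q] is
    the unique minimizer ([mixture_minimizer], [mixture_unique]). It tends to
    [pi] as [w] grows.

    The minimum value lies between [D(mu|q)], because [D(pi|q) >= 0], and
    [D(mu|pi)], the value of the objective at [p = pi]. Since [q] tends to
    [pi], a positive limit, continuity of the logarithm and a squeeze give
    convergence of the value to [D(mu|pi)] ([objective_mixture_cvg]). The
    minimum of finitely many extended reals depends continuously on them, so
    the minimum over [S] converges too. *)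

(** * Relative entropy and Gibbs' inequality *)

Section RelativeEntropy.
Context {R : realType} {Y : finType}.
Implicit Types p q mu pi : Y -> R.

(** Relative entropy as a real number; it agrees with [kl] when both
    arguments have full support ([kl_fin]). *)
Definition klr p q : R := \sum_y p y * ln (p y / q y).

Lemma kl_fin p q : full_support p -> full_support q -> kl p q = (klr p q)%:E.
Proof.
move=> p0 q0; rewrite /kl /klr -sumEFin; apply: eq_bigr => y _.
by rewrite /kl_term !gt_eqF.
Qed.

Lemma kl_eqy p q y : full_support p -> q y = 0 -> kl p q = +oo%E.
Proof.
move=> p0 qy0; apply/eqP.
rewrite /kl (@esum_eqy _ _ predT) => [|z _]; last first.
  by rewrite /kl_term; case: ifP => // _; case: ifP.
by apply/existsP; exists y; rewrite /= /kl_term (gt_eqF (p0 y)) qy0 eqxx.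
Qed.

Lemma full_support_or_zero p : distributions p ->
  full_support p \/ exists y, p y = 0.
Proof.
move=> [p0 _]; have [[y py]|np] := pselect (exists y, p y = 0).
  by right; exists y.
left=> y; rewrite lt_neqAle p0 andbT eq_sym; apply/eqP => py.
by apply: np; exists y.
Qed.

(** The strict form of [ln t <= t - 1], at [t = y / x]; it gives Gibbs'
    inequality term by term. *)
Lemma kl_term_gt (x y : R) : 0 < x -> 0 < y -> x != y ->
  x - y < x * ln (x / y).
Proof.
move=> x0 y0 xy; have yx0 : 0 < y / x by rewrite divr_gt0.
have t0 : ln (y / x) != 0.
  rewrite ln_eq0//; apply: contra xy => /eqP h.
  by rewrite eq_sym -subr_eq0 -[y](divfK (lt0r_neq0 x0)) h mul1r subrr.
have := expR_gt1Dx t0; rewrite lnK ?posrE// ltr_pdivlMr//.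
rewrite -[x / y]invf_div lnV ?posrE//; nra.
Qed.

(** Gibbs' inequality; [klr_le0_eq] is its equality case. *)
Lemma klr_ge0 p q : full_support p -> full_support q ->
  \sum_y p y = \sum_y q y -> 0 <= klr p q.
Proof.
move=> p0 q0 pq; have -> : 0 = \sum_y (p y - q y) by rewrite sumrB pq subrr.
apply: ler_sum => y _; have [->|ne] := eqVneq (p y) (q y).
  by rewrite subrr divff ?ln1 ?mulr0// gt_eqF.
exact/ltW/kl_term_gt.
Qed.

Lemma klr_le0_eq p q : full_support p -> full_support q ->
  \sum_y p y = \sum_y q y -> klr p q <= 0 -> p = q.
Proof.
move=> p0 q0 pq kl0; apply/funext => y; apply/eqP/negPn/negP => ne.
suff : \sum_z (p z - q z) < klr p q.
  by rewrite sumrB pq subrr => /lt_le_trans/(_ kl0); rewrite ltxx.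
rewrite /klr (bigD1 y)//= [ltRHS](bigD1 y)//=.
apply: ltr_leD; first exact: kl_term_gt.
apply: ler_sum => z _; have [->|nz] := eqVneq (p z) (q z).
  by rewrite subrr divff ?ln1 ?mulr0// gt_eqF.
exact/ltW/kl_term_gt.
Qed.

Lemma klr_cvgr p q (r : nat -> Y -> R) :
  full_support p -> full_support q ->
  (forall y, r n y @[n --> \oo] --> q y) ->
  klr p (r n) @[n --> \oo] --> klr p q.
Proof.
move=> p0 q0 rq; apply: cvg_big => [|y _]; first exact: add_continuous.
apply: cvgM; first exact: cvg_cst.
apply: (@cvg_comp _ _ _ _ (@ln R) _ (nbhs (p y / q y))).
  apply: cvgM; first exact: cvg_cst.
  by apply: cvgV => //; rewrite gt_eqF.
by apply: continuous_ln; rewrite divr_gt0.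
Qed.

End RelativeEntropy.

(** * The mixture of the outlier and typical distributions *)

Section Mixture.
Context {R : realType} {Y : finType}.
Implicit Types p mu pi : Y -> R.

(** The mixture of [mu] and [pi] with weights proportional to [1] and [w]. *)
Definition mixture (w : R) mu pi : Y -> R :=
  fun y => (mu y + w * pi y) / (1 + w).

Lemma mixture_full_support w mu pi : 0 <= w ->
  full_support mu -> full_support pi -> full_support (mixture w mu pi).
Proof.
move=> w0 mu0 pi0 y; rewrite /mixture divr_gt0//; last by lra.
by rewrite ltr_wpDr// mulr_ge0// ltW.
Qed.

Lemma mixture_distributions w mu pi : 0 <= w ->
  distributions mu -> distributions pi -> distributions (mixture w mu pi).
Proof.
move=> w0 [mu0 mu1] [pi0 pi1]; split=> [y|].
  rewrite /mixture divr_ge0//; last by lra.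
  by rewrite addr_ge0// mulr_ge0.
rewrite /mixture -mulr_suml big_split/= -mulr_sumr mu1 pi1 mulr1 divff//.
by rewrite gt_eqF//; lra.
Qed.

Lemma mixture_cvg mu pi (w : nat -> R) : w n @[n --> \oo] --> +oo ->
  forall y, mixture (w n) mu pi y @[n --> \oo] --> pi y.
Proof.
move=> woo y.
have w1oo : (1 + w n) @[n --> \oo] --> +oo.
  apply/cvgryPge => A; move/cvgryPge: woo => /(_ A); apply: filterS => n; lra.
have w1pos : \forall n \near \oo, 0 < 1 + w n by move/cvgryPgt: w1oo; apply.
have inv0 : (1 + w n)^-1 @[n --> \oo] --> (0 : R).
  exact/(gtr0_cvgV0 w1pos).
(* the mixture is [pi + (mu - pi) / (1 + w)] *)
have : pi y + (mu y - pi y) * (1 + w n)^-1 @[n --> \oo] --> pi y.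
  rewrite -[X in _ --> X]addr0 -(mulr0 (mu y - pi y)).
  by apply: cvgD; last apply: cvgM => //; exact: cvg_cst.
apply: cvg_trans; apply: near_eq_cvg; apply: filterS w1pos => n n0.
by rewrite /mixture; field; rewrite gt_eqF.
Qed.

(** The compensation identity; it holds term by term, so none of the three
    functions needs to sum to 1. *)
Lemma klr_compensation w mu pi p : 0 <= w ->
  full_support mu -> full_support pi -> full_support p ->
  let q := mixture w mu pi in
  klr mu p + w * klr pi p = klr mu q + w * klr pi q + (1 + w) * klr q p.
Proof.
move=> w0 mu0 pi0 p0 q; have q0 : full_support q by exact: mixture_full_support.
have qE y : (1 + w) * q y = mu y + w * pi y.
  by rewrite /q /mixture mulrC divfK// gt_eqF//; lra.
(* only [qE] is needed from here on; with [q] opaque, [ln (q y)] is not split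
   as the logarithm of a quotient *)
move: q q0 qE => q q0 qE.
rewrite /klr !mulr_sumr -!big_split/=; apply: eq_bigr => y _.
rewrite !ln_div ?posrE// [(1 + w) * _]mulrA qE; ring.
Qed.

End Mixture.

(** * The unique minimizer and its value *)

Section Objective.
Context {R : realType} {Y : finType} (K M : nat) (mu pi : Y -> R).
Hypotheses (mu_d : distributions mu) (pi_d : distributions pi).
Hypotheses (mu_fs : full_support mu) (pi_fs : full_support pi).
Let w : R := (M - 2 * K)%:R.
Let q := mixture w mu pi.
Let w0 : 0 <= w. Proof. exact: ler0n. Qed.
Let q_fs : full_support q. Proof. exact: mixture_full_support. Qed.
Let q_d : distributions q. Proof. exact: mixture_distributions. Qed.

Lemma objective_fin p : full_support p ->
  objective K M mu pi p = (klr mu p + w * klr pi p)%:E.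
Proof. by move=> p0; rewrite /objective !kl_fin. Qed.

Lemma objective_eqy p y : p y = 0 -> objective K M mu pi p = +oo%E.
Proof.
move=> py; rewrite /objective (kl_eqy mu_fs py) (kl_eqy pi_fs py).
by rewrite addye// gt_eqF// (lt_le_trans ltNy0)// mule_ge0// lee_fin.
Qed.

Lemma mixture_minimizer :
  is_minimizer (@distributions R Y) (objective K M mu pi) q.
Proof.
split=> // p p_d; have [p_fs|[y py]] := full_support_or_zero p_d; last first.
  by rewrite (objective_eqy py) leey.
rewrite !objective_fin// lee_fin (klr_compensation w0 mu_fs pi_fs p_fs).
rewrite lerDl mulr_ge0 ?addr_ge0//.
by apply: klr_ge0 => //; rewrite q_d.2 p_d.2.
Qed.

Lemma mixture_unique p :
  is_minimizer (@distributions R Y) (objective K M mu pi) p -> q = p.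
Proof.
move=> [p_d pmin]; have := pmin _ q_d.
have [p_fs|[y py]] := full_support_or_zero p_d; last first.
  by rewrite (objective_eqy py) objective_fin// leye_eq.
rewrite !objective_fin// lee_fin (klr_compensation w0 mu_fs pi_fs p_fs).
rewrite -[leRHS]addr0 lerD2l pmulr_rle0 ?ltr_wpDr//.
by apply: klr_le0_eq => //; rewrite q_d.2 p_d.2.
Qed.

Lemma ereal_inf_objective :
  ereal_inf [set objective K M mu pi p | p in @distributions R Y] =
  objective K M mu pi q.
Proof.
apply/eqP; rewrite eq_le; apply/andP; split.
  by apply: ereal_inf_lbound; exists q.
apply: le_ereal_inf_tmp => _ [p p_d <-]; exact: mixture_minimizer.2.
Qed.

Lemma objective_mixture_bounds :
  ((klr mu q)%:E <= objective K M mu pi q <= (klr mu pi)%:E)%E.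
Proof.
apply/andP; split.
  rewrite objective_fin// lee_fin lerDl mulr_ge0// klr_ge0//.
  by rewrite pi_d.2 q_d.2.
apply: le_trans (mixture_minimizer.2 _ pi_d) _.
(* [D(pi|pi) = 0] *)
rewrite objective_fin// lee_fin -[leRHS]addr0 lerD2l.
rewrite /klr big1 ?mulr0// => y _.
by rewrite divff ?ln1 ?mulr0// gt_eqF.
Qed.

End Objective.

(** * The limit of many sequences *)

Section Limit.
Context {R : realType} {Y : finType} (K : nat) (mu pi : Y -> R).
Hypotheses (mu_d : distributions mu) (pi_d : distributions pi).
Hypotheses (mu_fs : full_support mu) (pi_fs : full_support pi).

Lemma weight_cvgy : ((M - 2 * K)%:R : R) @[M --> \oo] --> +oo.
Proof. exact: cvg_comp (cvg_subnr _) cvgr_idn. Qed.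

Lemma minimizer_cvg y :
  mixture (M - 2 * K)%:R mu pi y @[M --> \oo] --> pi y.
Proof. exact: mixture_cvg weight_cvgy _. Qed.

Lemma objective_mixture_cvg :
  objective K M mu pi (mixture (M - 2 * K)%:R mu pi) @[M --> \oo] -->
  kl mu pi.
Proof.
rewrite kl_fin//; apply: (@squeeze_cvge _ _ _ _
  (fun M => (klr mu (mixture (M - 2 * K)%:R mu pi))%:E) _
  (fun=> (klr mu pi)%:E)).
- by apply: nearW => M; exact: objective_mixture_bounds.
- apply: cvg_EFin; first exact: nearW.
  exact: klr_cvgr minimizer_cvg.
- exact: cvg_cst.
Qed.

End Limit.

Lemma min_over_cvg (R : realType) (S : {fset nat}) (f : nat -> nat -> \bar R)
    (a : nat -> \bar R) :
  (forall i, i \in S -> f n i @[n --> \oo] --> a i) ->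
  min_over S (f n) @[n --> \oo] --> min_over S a.
Proof.
move=> fa; rewrite /min_over big_seq.
rewrite (_ : (fun n => _) =
    (fun n => \big[Order.min/+oo%E]_(i <- S | i \in S) f n i)); last first.
  by apply/funext => n; rewrite big_seq.
exact: (cvg_big (Ff := fun i n => f n i) min_continuous).
Qed.

Theorem mainTheorem6 (R : realType) (Y : finType) (K : nat) (S : {fset nat})
    (pi : Y -> R) (mu : nat -> Y -> R)
    (hK : (2 < K)%N) (hS : #|` S| = K)
    (hpi : distributions pi) (hpi_full : full_support pi)
    (hmu : forall i : nat, i \in S -> distributions (mu i))
    (hmu_full : forall i : nat, i \in S -> full_support (mu i))
    (hmu_pi : forall i : nat, i \in S -> mu i <> pi) :
  (forall i : nat, i \in S ->
    (forall M : nat, (2 * K < M)%N ->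
       exists! p : Y -> R,
         is_minimizer (@distributions R Y) (objective K M (mu i) pi) p) /\
    (forall pstar : nat -> Y -> R,
       (forall M : nat, (2 * K < M)%N ->
          is_minimizer (@distributions R Y) (objective K M (mu i) pi)
            (pstar M)) ->
       forall y : Y, pstar M y @[M --> \oo] --> pi y)) /\
  coef_unknown S K M mu pi @[M --> \oo] --> coef_known_typical S mu pi.
Proof.
have minimizerE i M p : i \in S ->
    is_minimizer (@distributions R Y) (objective K M (mu i) pi) p ->
    mixture (M - 2 * K)%:R (mu i) pi = p.
  move=> iS; apply: mixture_unique => //; [exact: hmu|exact: hmu_full].
split=> [i iS|].
  split=> [M _|pstar hp y].
    exists (mixture (M - 2 * K)%:R (mu i) pi); split.
      by apply: mixture_minimizer => //; [exact: hmu|exact: hmu_full].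
    by move=> p; exact: minimizerE.
  have := @minimizer_cvg R Y K (mu i) pi y; apply: cvg_trans.
  apply: near_eq_cvg; exists (2 * K).+1 => // M /= KM.
  by rewrite (minimizerE i M (pstar M))//; exact: hp.
apply: min_over_cvg => i iS.
rewrite (_ : (fun M => _) =
    fun M => objective K M (mu i) pi (mixture (M - 2 * K)%:R (mu i) pi)).
  by apply: objective_mixture_cvg => //; [exact: hmu|exact: hmu_full].
apply/funext => M.
by apply: ereal_inf_objective => //; [exact: hmu|exact: hmu_full].
Qed.
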